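(* Let $(X,d_X,\mu,T)$ and $(Y,d_Y,\nu,S)$ be compact metric measure-preserving systems with $T,S$ continuous, fix anchor sequences $(a_r)$ dense in $\operatorname{supp}\mu$ and $(b_r)$ dense in $\operatorname{supp}\nu$, and let $\lambda_0=\mu\otimes\nu$. (1) If $\lambda\in\mathcal J(T,S)$ and $\lambda\ne\lambda_0$, then there are integers $n,m,R\ge1$ and a $1$-Lipschitz continuous function $\psi$ on the finite anchored array cube such that $\int\psi\,d\widetilde\Phi_{n,m,R}(\lambda)\ne\int\psi\,d\widetilde\Phi_{n,m,R}(\lambda_0)$. (2) For every weak neighborhood $\mathcal U$ of $\lambda_0$ in $\mathcal J(T,S)$, there exist finitely many triples $(n_\ell,m_\ell,R_\ell)$, $1$-Lipschitz continuous functions $\psi_\ell$ on the corresponding anchored array cubes, and $\varepsilon>0$ such that every $\lambda\in\mathcal J(T,S)$ satisfying $\bigl|\int\psi_\ell\,d\widetilde\Phi_{n_\ell,m_\ell,R_\ell}(\lambda)-\int\psi_\ell\,d\widetilde\Phi_{n_\ell,m_\ell,R_\ell}(\lambda_0)\bigr|<\varepsilon$ for every $\ell$ belongs to $\mathcal U$.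
   Context: A compact metric measure-preserving system $(X,d_X,\mu,T)$: $(X,d_X)$ compact metric, $\mu$ Borel probability, $T$ Borel with $T_\#\mu=\mu$. $\mathcal J(T,S)$: Borel probability measures on $X\times Y$ with marginals $\mu,\nu$ invariant under $T\times S$, with the weak topology. For $z_i=(x_i,y_i)$: $\widetilde{\mathcal D}^X_{n,m,R}=\bigl((d_X(T^ax_i,T^bx_j))_{1\le i,j\le n,0\le a,b<m},(d_X(T^ax_i,a_r))_{1\le i\le n,0\le a<m,1\le r\le R}\bigr)$, $\widetilde{\mathcal D}^Y_{n,m,R}$ analogously with $d_Y,S,b_r$; these take values in a compact cube (the finite anchored array cube, with a product Euclidean metric), and $\widetilde\Phi_{n,m,R}(\lambda)=\mathrm{Law}_{\lambda^{\otimes n}}(\widetilde{\mathcal D}^X_{n,m,R},\widetilde{\mathcal D}^Y_{n,m,R})$. *)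

(* Defs.v *)
From HB Require Import structures.
From mathcomp Require Import all_boot all_order all_algebra.
From mathcomp Require Import all_classical all_reals all_analysis.
Unset Printing Implicit Defensive.
Import Order.TTheory GRing.Theory Num.Theory.
Import numFieldNormedType.Exports.
Local Open Scope classical_set_scope.
Local Open Scope ring_scope.

Section Defs.
Context {R : realType}.

Definition is_metric {X : Type} (dX : X -> X -> R) : Prop :=
  (forall x y, 0 <= dX x y) /\ (forall x y, dX x y = 0 <-> x = y) /\
  (forall x y, dX x y = dX y x) /\ (forall x y z, dX x z <= dX x y + dX y z).

Definition metric_compact {X : Type} (dX : X -> X -> R) : Prop :=
  forall u : nat -> X, exists (phi : nat -> nat) (x : X),
    {homo phi : a b / (a < b)%N} /\ (fun k => dX (u (phi k)) x) @ \oo --> (0 : R).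

Definition dopen {X : Type} (dX : X -> X -> R) (A : set X) : Prop :=
  forall x, A x -> exists2 e : R, 0 < e & forall y, dX x y < e -> A y.

Definition dball {X : Type} (dX : X -> X -> R) (x : X) (e : R) : set X :=
  [set y | dX x y < e].

Definition dcontinuous {X Y : Type} (dX : X -> X -> R) (dY : Y -> Y -> R)
  (f : X -> Y) : Prop :=
  forall x (e : R), 0 < e -> exists2 d : R, 0 < d &
    forall y, dX x y < d -> dY (f x) (f y) < e.

Definition borel_for {d} {X : measurableType d} (dX : X -> X -> R) : Prop :=
  @measurable d X = <<s [set A | dopen dX A] >>.

Definition msupport {d} {X : measurableType d} (dX : X -> X -> R)
  (mu : set X -> \bar R) : set X :=
  [set x | forall e : R, 0 < e -> (0 < mu (dball dX x e))%E].

Definition dense_in_support {d} {X : measurableType d} (dX : X -> X -> R)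
  (mu : set X -> \bar R) (a : nat -> X) : Prop :=
  (forall r, msupport dX mu (a r)) /\
  (forall x, msupport dX mu x -> forall e : R, 0 < e -> exists r, dX x (a r) < e).

Definition preserves {d} {X : measurableType d} (mu : set X -> \bar R) (T : X -> X) : Prop :=
  measurable_fun setT T /\ forall A, measurable A -> mu (T @^-1` A) = mu A.

Definition joining {dx dy} {X : measurableType dx} {Y : measurableType dy}
  (mu : set X -> \bar R) (nu : set Y -> \bar R) (T : X -> X) (S : Y -> Y)
  (lam : set (X * Y)%type -> \bar R) : Prop :=
  (forall A, measurable A -> lam (A `*` setT) = mu A) /\
  (forall B, measurable B -> lam (setT `*` B) = nu B) /\
  (forall C, measurable C -> lam ((fun z => (T z.1, S z.2)) @^-1` C) = lam C).

Definition diam {X : Type} (dX : X -> X -> R) : R :=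
  sup [set r | exists x y, r = dX x y].

(* index set of an anchored array for one coordinate:
   inl (i,a,j,b) ~ d(T^a x_i, T^b x_j); inr (i,a,r) ~ d(T^a x_i, a_r) *)
Definition arrIdx (n m Ra : nat) : finType :=
  (('I_n * 'I_m * 'I_n * 'I_m) + ('I_n * 'I_m * 'I_Ra))%type.

Definition fullIdx (n m Ra : nat) : finType := (arrIdx n m Ra + arrIdx n m Ra)%type.

Definition anchored_array {X : Type} (dX : X -> X -> R) (T : X -> X) (a : nat -> X)
  (n m Ra : nat) (x : 'I_n -> X) : arrIdx n m Ra -> R :=
  fun k => match k with
  | inl (i, p, j, q) => dX (iter p T (x i)) (iter q T (x j))
  | inr (i, p, r) => dX (iter p T (x i)) (a r)
  end.

Definition full_array {X Y : Type} (dX : X -> X -> R) (dY : Y -> Y -> R)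
  (T : X -> X) (S : Y -> Y) (a : nat -> X) (b : nat -> Y) (n m Ra : nat)
  (z : n.-tuple (X * Y)) : fullIdx n m Ra -> R :=
  fun k => match k with
  | inl k' => anchored_array dX T a n m Ra (fun i => (tnth z i).1) k'
  | inr k' => anchored_array dY S b n m Ra (fun i => (tnth z i).2) k'
  end.

Definition array_cube {X Y : Type} (dX : X -> X -> R) (dY : Y -> Y -> R)
  (n m Ra : nat) : set (fullIdx n m Ra -> R) :=
  [set v | forall k, match k with
                     | inl k' => 0 <= v (inl k') <= diam dX
                     | inr k' => 0 <= v (inr k') <= diam dY
                     end].

Definition eucl_dist {I : finType} (v w : I -> R) : R :=
  Num.sqrt (\sum_(k : I) (v k - w k) ^+ 2).

Definition lipschitz1_on {I : finType} (C : set (I -> R)) (psi : (I -> R) -> R) : Prop :=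
  forall v w, C v -> C w -> `|psi v - psi w| <= eucl_dist v w.

(* integral of F against lam^{(x) n}, as the iterated integral *)
Fixpoint prod_integral {d} {Z : measurableType d} (lam : {measure set Z -> \bar R}) (n : nat)
  : (n.-tuple Z -> R) -> R :=
  match n return (n.-tuple Z -> R) -> R with
  | 0 => fun F => F [tuple]
  | k.+1 => fun F => Rintegral lam setT
             (fun z => prod_integral lam k (fun t : k.-tuple Z => F [tuple of z :: t]))
  end.

Definition Phi_integral {dx dy} {X : measurableType dx} {Y : measurableType dy}
  (dX : X -> X -> R) (dY : Y -> Y -> R) (T : X -> X) (S : Y -> Y)
  (a : nat -> X) (b : nat -> Y) (n m Ra : nat)
  (psi : (fullIdx n m Ra -> R) -> R) (lam : {measure set (X * Y)%type -> \bar R}) : R :=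
  prod_integral lam n (fun z => psi (full_array dX dY T S a b n m Ra z)).

Definition prod_continuous {X Y : Type} (dX : X -> X -> R) (dY : Y -> Y -> R)
  (f : X * Y -> R) : Prop :=
  forall z (e : R), 0 < e -> exists2 dl : R, 0 < dl &
    forall w, dX z.1 w.1 < dl -> dY z.2 w.2 < dl -> `|f z - f w| < e.

Definition weak_nbhd_in_J {dx dy} {X : measurableType dx} {Y : measurableType dy}
  (dX : X -> X -> R) (dY : Y -> Y -> R)
  (mu : set X -> \bar R) (nu : set Y -> \bar R) (T : X -> X) (S : Y -> Y)
  (lam0 : {measure set (X * Y)%type -> \bar R}) (U : set (probability (X * Y)%type R)) : Prop :=
  exists (k : nat) (f : 'I_k -> X * Y -> R) (dl : R),
    (forall i, prod_continuous dX dY (f i)) /\ 0 < dl /\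
    forall lam : probability (X * Y)%type R, joining mu nu T S lam ->
      (forall i, `|Rintegral lam setT (f i) - Rintegral lam0 setT (f i)| < dl) ->
      U lam.

End Defs.

(* Main.v *)
(** Arrays with [n = m = 1] suffice: they record the distances from a point of
    [X * Y] to the first anchors.  By sequential compactness and density of the
    anchors in the supports, a continuous [f] on [X * Y] varies by less than [e]
    between points of [supp mu * supp nu] whose arrays are close, so
    [f z <= f w + L |D z - D w| + e] there for some [L], and the McShane extension
    [v |-> inf_w (f w + L |v - D w|)] is a Lipschitz function of arrays that
    approximates [f] uniformly within [e] on [supp mu * supp nu].  Every joining is
    carried by that set, so array integrals control the integral of [f]: this gives
    (2), and also (1) since continuous functions determine a measure. *)
Require Import Defs.
From mathcomp Require Import all_boot all_order all_algebra.
From mathcomp Require Import all_classical all_reals all_analysis.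
From mathcomp Require Import lra.
Import Order.TTheory GRing.Theory Num.Theory.
Import numFieldNormedType.Exports.
Local Open Scope classical_set_scope.
Local Open Scope ring_scope.

(** * Product metric, sequential compactness and uniform separation *)

(** The sum metric induces the product topology and keeps every estimate on the product linear in
    the two distances. *)
Definition dsum {R : realType} {X Y : Type} (dX : X -> X -> R) (dY : Y -> Y -> R)
  (z w : X * Y) : R := dX z.1 w.1 + dY z.2 w.2.

Lemma is_metric_dsum {R : realType} {X Y : Type} (dX : X -> X -> R) (dY : Y -> Y -> R) :
  is_metric dX -> is_metric dY -> is_metric (dsum dX dY).
Proof.
move=> [X0 [Xe [Xs Xt]]] [Y0 [Ye [Ys Yt]]]; rewrite /dsum; split; [|split; [|split]].
- by move=> z w; rewrite addr_ge0.
- move=> [x y] [x' y'] /=; split.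
    move/eqP; rewrite paddr_eq0// => /andP[/eqP h1 /eqP h2].
    by rewrite (Xe x x').1 // (Ye y y').1.
  by move=> [-> ->]; rewrite (Xe x' x').2 // (Ye y' y').2 // addr0.
- by move=> z w; rewrite Xs Ys.
- move=> z w t; have := Xt z.1 w.1 t.1; have := Yt z.2 w.2 t.2; lra.
Qed.

Lemma metric_refl {R : realType} {X : Type} (dX : X -> X -> R) (x : X) :
  is_metric dX -> dX x x = 0.
Proof. by move=> [_ [e _]]; apply/e. Qed.

Lemma metric_lip {R : realType} {X : Type} (dX : X -> X -> R) (c x y : X) :
  is_metric dX -> `|dX x c - dX y c| <= dX x y.
Proof.
move=> [_ [_ [s t]]]; have := t x y c; have := t y x c; rewrite (s y x) => h1 h2.
by rewrite ler_norml; apply/andP; split; lra.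
Qed.

Lemma homo_ltn_geq {f : nat -> nat} :
  {homo f : a b / (a < b)%N} -> forall k, (k <= f k)%N.
Proof. by move=> h; elim=> // k ih; exact: (leq_ltn_trans ih (h _ _ (ltnSn k))). Qed.

Lemma compact_subseq {R : realType} {X : Type} (dX : X -> X -> R) :
  is_metric dX -> metric_compact dX -> forall u : nat -> X,
  exists (phi : nat -> nat) (x : X), {homo phi : a b / (a < b)%N} /\
    forall e : R, 0 < e -> \forall k \near \oo, dX (u (phi k)) x < e.
Proof.
move=> [d0 _] cX u; have [phi [x [hphi /cvgr0Pnorm_lt hc]]] := cX u.
exists phi, x; split => // e e0; have := hc e e0.
by apply: filterS => k; rewrite ger0_norm.
Qed.

Lemma near_subseq {phi : nat -> nat} {P : nat -> Prop} :
  {homo phi : a b / (a < b)%N} -> (\forall k \near \oo, P k) ->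
  \forall k \near \oo, P (phi k).
Proof.
move=> hphi [N _ hN]; exists N => // k /= Nk.
by apply: hN => /=; exact: (leq_trans Nk (homo_ltn_geq hphi k)).
Qed.

Lemma metric_compact_dsum {R : realType} {X Y : Type}
  (dX : X -> X -> R) (dY : Y -> Y -> R) :
  is_metric dX -> is_metric dY ->
  metric_compact dX -> metric_compact dY -> metric_compact (dsum dX dY).
Proof.
move=> mX mY cX cY u.
have [p [x [hp hx]]] := compact_subseq _ mX cX (fun k => (u k).1).
have [q [y [hq hy]]] := compact_subseq _ mY cY (fun k => (u (p k)).2).
exists (p \o q), (x, y); split; first by move=> i j ij; apply/hp/hq.
apply/cvgr0Pnorm_lt => e e0.
have := near_subseq hq (hx _ (divr_gt0 e0 (ltr0n _ 2))).
have := hy _ (divr_gt0 e0 (ltr0n _ 2)).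
apply: filterS2 => k; rewrite /dsum /= => h1 h2.
case: mX mY => X0 _ [Y0 _]; rewrite ger0_norm ?addr_ge0 //; lra.
Qed.

Lemma near_inv_lt {R : realType} (e : R) : 0 < e -> \forall k \near \oo, k.+1%:R^-1 < e.
Proof. by move=> e0; exact: (near_infty_natSinv_lt (PosNum e0)). Qed.

Definition rdist {R : realType} (x y : R) : R := `|x - y|.

Lemma dcontinuous_bounded {R : realType} {Z : Type} (d : Z -> Z -> R) (f : Z -> R) :
  is_metric d -> metric_compact d -> dcontinuous d rdist f ->
  exists M : R, forall z, `|f z| <= M.
Proof.
move=> md cd cf; apply: contrapT => /forallNP nb.
have /choice[u hu] : forall k : nat, exists z, k%:R < `|f z|.
  move=> k; have /existsNP[z hz] := nb k%:R.
  by exists z; rewrite ltNge; apply/negP.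
have [p [z [hp hz]]] := compact_subseq _ md cd u.
have [dl dl0 hdl] := cf z 1 ltr01.
near \oo => k.
have h1 : `|f z - f (u (p k))| < 1.
  by apply: hdl; case: md => _ [_ [-> _]]; near: k; exact: hz.
have h2 : `|f z| + 1 <= k%:R by near: k; exact: nbhs_infty_ger.
have h3 : k%:R <= (p k)%:R :> R by rewrite ler_nat homo_ltn_geq.
have := hu (p k); have := ler_distD 0 (f (u (p k))) (f z).
have := ler_distD (f z) (f (u (p k))) 0; rewrite !subr0 (distrC _ (f z)); lra.
Unshelve. all: by end_near. Qed.

(** Otherwise there are pairs in [K] with [f]-values at least [e] apart although the first [k]
    functions differ by less than 1/(k+1). A subsequence converges to a pair in [K]; since the [g r]
    are 1-Lipschitz they agree on this pair, so its two points coincide, which contradicts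
    continuity of [f] there. *)
Lemma separating_modulus {R : realType} {Z : Type} (d : Z -> Z -> R) (K : set Z)
  (g : nat -> Z -> R) (f : Z -> R) (e : R) :
  is_metric d -> metric_compact d ->
  (forall z, (forall r : R, 0 < r -> exists2 w, K w & d w z < r) -> K z) ->
  (forall r z w, `|g r z - g r w| <= d z w) ->
  (forall z w, K z -> K w -> (forall r, g r z = g r w) -> z = w) ->
  dcontinuous d rdist f -> 0 < e ->
  exists (N : nat) (eta : R), 0 < eta /\
    forall z w, K z -> K w -> (forall r, (r < N)%N -> `|g r z - g r w| < eta) ->
      `|f z - f w| < e.
Proof.
move=> md cd clK lg sg cf e0; apply: contrapT => nh.
have /choice[u hu] : forall k : nat, exists zw : Z * Z,
    [/\ K zw.1, K zw.2, forall r, (r < k)%N -> `|g r zw.1 - g r zw.2| < k.+1%:R^-1 &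
      e <= `|f zw.1 - f zw.2|].
  (* Tying the threshold 1/(k+1) to the number [k] of tested functions lets one sequence refute all
     choices of [N] and [eta]. *)
  move=> k; apply: contrapT => nk; apply: nh; exists k, k.+1%:R^-1.
  rewrite invr_gt0 ltr0n; split => // z w Kz Kw hzw.
  by rewrite ltNge; apply/negP => ef; apply: nk; exists (z, w).
have mdd := is_metric_dsum _ _ md md.
have [p [[z w] [hp hz]]] :=
  compact_subseq _ mdd (metric_compact_dsum _ _ md md cd cd) u.
have [d0 [_ [ds _]]] := md.
have hz1 r : 0 < r -> \forall k \near \oo, d (u (p k)).1 z < r.
  move=> r0; apply: filterS (hz r r0) => k; rewrite /dsum /=.
  have := d0 (u (p k)).2 w; lra.
have hz2 r : 0 < r -> \forall k \near \oo, d (u (p k)).2 w < r.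
  move=> r0; apply: filterS (hz r r0) => k; rewrite /dsum /=.
  have := d0 (u (p k)).1 z; lra.
have Kz : K z.
  apply: clK => r r0; have [k hk] := filter_ex (hz1 r r0).
  by exists (u (p k)).1 => //; case: (hu (p k)).
have Kw : K w.
  apply: clK => r r0; have [k hk] := filter_ex (hz2 r r0).
  by exists (u (p k)).2 => //; case: (hu (p k)).
have zw : z = w.
  (* A gap [s] between [g r z] and [g r w] would be bridged by three steps shorter than [s / 3],
     through the two approximating points. *)
  apply: sg => // r; apply/eqP; rewrite -subr_eq0 -normr_le0 leNgt; apply/negP => rp.
  set s := `|_| in rp; have s3 : 0 < s / 3 by rewrite divr_gt0.
  near \oo => k.
  have h1 : d (u (p k)).1 z < s / 3 by near: k; exact: hz1.
  have h2 : d (u (p k)).2 w < s / 3 by near: k; exact: hz2.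
  have h3 : (p k).+1%:R^-1 < s / 3.
    by near: k; exact: (near_subseq hp (near_inv_lt _ s3)).
  have h4 : (r < p k)%N.
    by apply: (@leq_trans k); [near: k; exact: nbhs_infty_gt|exact: homo_ltn_geq].
  have [_ _ /(_ _ h4) /lt_trans/(_ h3) h5 _] := hu (p k).
  have h6 := lg r (u (p k)).1 z; have h7 := lg r (u (p k)).2 w.
  have : s <= `|g r (u (p k)).1 - g r z| + `|g r (u (p k)).1 - g r (u (p k)).2|
            + `|g r (u (p k)).2 - g r w|.
    rewrite (distrC _ (g r z)).
    by apply: (le_trans (ler_distD (g r (u (p k)).2) _ _)); rewrite lerD2r ler_distD.
  lra.
subst w.
have [dl dl0 hdl] := cf z (e / 2) (divr_gt0 e0 (ltr0n _ 2)).
near \oo => k.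
have h1 : `|f z - f (u (p k)).1| < e / 2.
  by apply: hdl; rewrite ds; near: k; exact: hz1.
have h2 : `|f z - f (u (p k)).2| < e / 2.
  by apply: hdl; rewrite ds; near: k; exact: hz2.
have [_ _ _ ] := hu (p k); have := ler_distD (f z) (f (u (p k)).1) (f (u (p k)).2).
rewrite (distrC _ (f z)); lra.
Unshelve. all: by end_near. Qed.

(** * Total boundedness and separability *)

(** If no finite list is an [e]-net, points can be picked greedily at mutual distance at least [e].
    Two consecutive late terms of a convergent subsequence would both lie within [e / 2] of the
    limit. *)
Lemma totally_bounded {R : realType} {X : Type} (dX : X -> X -> R) (e : R) :
  is_metric dX -> metric_compact dX -> 0 < e ->
  exists s : seq X, forall x, exists2 i, (i < size s)%N & dX (nth x s i) x < e.
Proof.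
move=> mX cX e0; apply: contrapT => /forallNP ns.
have /choice[g hg] : forall s : seq X, exists x, forall y i, (i < size s)%N -> e <= dX (nth y s i) x.
  move=> s; have /existsNP[x hx] := ns s; exists x => y i si.
  rewrite leNgt; apply/negP => h; apply: hx; exists i => //.
  by rewrite (set_nth_default y).
(* [t k] lists the first [k] chosen points, so [g (t i)] is the point of index [i]. *)
pose t := fix t k := if k is k'.+1 then rcons (t k') (g (t k')) else [::].
have st k : size (t k) = k by elim: k => //= k ih; rewrite size_rcons ih.
have tn y k i : (i < k)%N -> nth y (t k) i = g (t i).
  elim: k => // k ih; rewrite ltnS leq_eqVlt => /orP[/eqP ->|ik] /=.
    by rewrite nth_rcons st ltnn eqxx.
  by rewrite nth_rcons st ik ih.
have [p [x [hp hx]]] := compact_subseq _ mX cX (fun k => g (t k)).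
have [N _ hN] := hx _ (divr_gt0 e0 (ltr0n _ 2)).
have h1 := hN N (leqnn N); have h2 := hN N.+1 (leqnSn N).
have := hg (t (p N.+1)) x (p N); rewrite st tn; last exact: hp.
move=> /(_ (hp _ _ (ltnSn N))); case: mX => _ [_ [s tr]].
have := tr (g (t (p N))) x (g (t (p N.+1))); rewrite (s x) /= in h1 h2 *; lra.
Qed.

(** The point of [X] pads the finite net at each scale to an infinite sequence. *)
Lemma compact_separable {R : realType} {X : Type} (dX : X -> X -> R) :
  X -> is_metric dX -> metric_compact dX ->
  exists c : nat -> nat -> X, forall k x, exists i, dX (c k i) x < k.+1%:R^-1.
Proof.
move=> x0 mX cX.
have /choice[s hs] : forall k : nat, exists s : seq X, forall x,
    exists2 i, (i < size s)%N & dX (nth x s i) x < k.+1%:R^-1.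
  by move=> k; apply: totally_bounded => //; rewrite invr_gt0 ltr0n.
exists (fun k i => nth x0 (s k) i) => k x; have [i si h] := hs k x.
by exists i; rewrite (set_nth_default x).
Qed.

(** * McShane extension and Lipschitz functions *)

(** [psi v] is the infimum of [F w + L * d v (D w)] over [w] in [K], finite because [M] bounds [F]
    below. The last two conclusions are its universal property. Letting [D] be any map into [V]
    covers both distance functions ([D = id]) and functions of arrays. *)
Lemma mcshane {R : realType} {V W : Type} (d : V -> V -> R) (K : set W) (F : W -> R)
  (D : W -> V) (L M : R) :
  K !=set0 -> 0 <= L -> (forall v w, 0 <= d v w) ->
  (forall u v w, d u w <= d u v + d v w) ->
  (forall w, K w -> M <= F w) ->
  exists psi : V -> R,
    [/\ forall v v', psi v <= psi v' + L * d v v',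
        forall v w, K w -> psi v <= F w + L * d v (D w) &
        forall v c, (forall w, K w -> c <= F w + L * d v (D w)) -> c <= psi v].
Proof.
move=> [w0 Kw0] L0 d0 dt FM.
pose E v := [set F w + L * d v (D w) | w in K].
have Eb v : has_lbound (E v).
  by exists M => _ [w Kw <-]; rewrite ler_wpDr ?FM// mulr_ge0.
have En v : E v !=set0 by exists (F w0 + L * d v (D w0)), w0.
exists (fun v => inf (E v)); split.
- move=> v v'; rewrite -lerBlDr; apply: lb_le_inf => // _ [w Kw <-].
  have : inf (E v) <= F w + L * d v (D w) by apply: ge_inf => //; exists w.
  have := ler_wpM2l L0 (dt v v' (D w)); rewrite mulrDr; lra.
- by move=> v w Kw; apply: ge_inf => //; exists w.
- by move=> v c hc; apply: lb_le_inf => // _ [w Kw <-]; exact: hc.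
Qed.

Definition dlipschitz {R : realType} {Z : Type} (d : Z -> Z -> R) (L : R) (f : Z -> R) : Prop :=
  forall z w, f z <= f w + L * d z w.

Lemma dlipschitz_dcontinuous {R : realType} {Z : Type} (d : Z -> Z -> R) (L : R)
  (f : Z -> R) : is_metric d -> 0 <= L -> dlipschitz d L f -> dcontinuous d rdist f.
Proof.
(* Dividing by [L + 1] also covers [L = 0]. *)
move=> [d0 [_ [ds _]]] L0 lf z e e0; exists (e / (L + 1)).
  by rewrite divr_gt0// ltr_wpDl.
move=> w; rewrite ltr_pdivlMr ?ltr_wpDl// mulrDr mulr1 mulrC => h.
have := lf z w; have := lf w z; rewrite (ds w z) => h1 h2.
have := d0 z w; rewrite /rdist ltr_norml => ?; apply/andP; split; lra.
Qed.

Lemma dopen_dball {R : realType} {X : Type} (dX : X -> X -> R) (x : X) (e : R) :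
  is_metric dX -> dopen dX (dball dX x e).
Proof.
move=> [_ [_ [_ tr]]] y; rewrite /dball /= => xy; exists (e - dX x y).
  by rewrite subr_gt0.
by move=> z; have := tr x y z; lra.
Qed.

Lemma measurable_dopen {R : realType} {d} {X : measurableType d} (dX : X -> X -> R)
  (A : set X) : borel_for dX -> dopen dX A -> measurable A.
Proof. by move=> bX oA; rewrite bX; exact: sub_sigma_algebra. Qed.

(** [g] is the distance to the complement, that is, the McShane extension of 0 from it. An empty
    complement leaves nothing to measure from, so the whole space takes a constant. *)
Lemma dopen_positive_set {R : realType} {X : Type} (dX : X -> X -> R) (A : set X) :
  is_metric dX -> dopen dX A ->
  exists2 g : X -> R, dlipschitz dX 1 g & A = [set x | 0 < g x].
Proof.
move=> [d0 [de [ds dt]]] oA; have [AT|] := pselect (~` A = set0).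
  exists (cst 1); first by move=> x y; rewrite mul1r lerDl.
  by rewrite -[LHS]setCK AT setC0; apply/seteqP; split=> //= x _; exact: ltr01.
move=> /eqP/set0P[y Ay].
have [psi [lp up dn]] := mcshane dX (~` A) (cst 0) id 1 0
  (ex_intro _ y Ay) ler01 d0 dt (fun _ _ => lexx 0).
exists psi => //; apply/seteqP; split => [x Ax|x /= px].
  have [e e0 he] := oA x Ax; apply: (lt_le_trans e0); apply: dn => w nAw.
  by rewrite add0r mul1r leNgt; apply/negP => /he.
apply: contrapT => nAx; have := up x x nAx.
by rewrite (de x x).2// mulr0 addr0 leNgt px.
Qed.

Lemma dlipschitz_min {R : realType} {Z : Type} (d : Z -> Z -> R) (L M : R) (f g : Z -> R) :
  is_metric d -> 0 <= L -> 0 <= M -> dlipschitz d L f -> dlipschitz d M g ->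
  dlipschitz d (L + M) (fun z => Num.min (f z) (g z)).
Proof.
move=> [d0 _] L0 M0 lf lg z w; have := lf z w; have := lg z w; rewrite mulrDl.
have := mulr_ge0 L0 (d0 z w); have := mulr_ge0 M0 (d0 z w) => h1 h2 h3 h4.
rewrite ge_min; case: (leP (f w) (g w)) => h; apply/orP; [left|right]; lra.
Qed.

(** * Supports of measures and separation by anchors *)

(** Each point outside the support lies in a null ball taken from a countable family, so countably
    many null balls cover the complement. *)
Lemma msupport_conull {R : realType} {d} {X : measurableType d} (dX : X -> X -> R)
  (mu : {measure set X -> \bar R}) :
  is_metric dX -> metric_compact dX -> borel_for dX ->
  exists N : set X, [/\ measurable N, mu N = 0%E & ~` N `<=` msupport dX mu].
Proof.
move=> mX cX bX; have [[x0 _]|nX] := pselect ([set: X] !=set0); last first.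
  exists set0; split => // x _; exfalso; by apply: nX; exists x.
have [c hc] := compact_separable _ x0 mX cX.
pose e k : R := k.+1%:R^-1.
have mB x r : measurable (dball dX x r).
  by apply: (measurable_dopen dX) => //; exact: dopen_dball.
(* Balls of positive measure are replaced by the empty set, so the union over all indices stays
   null. *)
pose B k i := if mu (dball dX (c k i) (e k)) == 0%E then dball dX (c k i) (e k) else set0.
have mBki k i : measurable (B k i) by rewrite /B; case: ifP.
have B0 k i : mu (B k i) = 0%E by rewrite /B; case: ifP => [/eqP//|_]; rewrite measure0.
have U0 (F : nat -> set X) : (forall i, measurable (F i)) -> (forall i, mu (F i) = 0%E) ->
    mu (\bigcup_i F i) = 0%E.
  move=> mF F0; apply/(@measure_negligible _ _ _ mu); first exact: bigcup_measurable.
  by apply: negligible_bigcup => k; exists (F k); split.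
exists (\bigcup_k \bigcup_i B k i); split.
- by apply: bigcup_measurable => k _; exact: bigcup_measurable.
- by apply: (U0) => [k|k]; [exact: bigcup_measurable|exact: (U0)].
move=> x nBx r r0; rewrite lt0e measure_ge0 andbT; apply/negP => /eqP xr0; apply: nBx.
(* With radius below [r / 2], the ball around [c k i] contains [x] and lies inside the null ball of
   radius [r] at [x]. *)
have [k hk] := filter_ex (near_inv_lt _ (divr_gt0 r0 (ltr0n _ 2))).
have [i hi] := hc k x; exists k => //; exists i => //.
rewrite /B (_ : mu _ = 0%E) ?eqxx//.
apply: (subset_measure0 (mB _ _) (mB x r) _ xr0) => y; rewrite /dball /=.
have := mX => -[_ [_ [s tr]]]; have := tr x (c k i) y; rewrite (s x (c k i)).
rewrite -/(e k) in hk hi *; lra.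
Qed.

Lemma msupport_closed {R : realType} {d} {X : measurableType d} (dX : X -> X -> R)
  (mu : {measure set X -> \bar R}) (x : X) :
  is_metric dX -> borel_for dX ->
  (forall r : R, 0 < r -> exists2 y, msupport dX mu y & dX y x < r) -> msupport dX mu x.
Proof.
move=> mX bX h r r0; have [y sy xy] := h (r / 2) (divr_gt0 r0 (ltr0n _ 2)).
apply: (lt_le_trans (sy (r / 2) (divr_gt0 r0 (ltr0n _ 2)))).
have mB z s : measurable (dball dX z s).
  by apply: (measurable_dopen dX) => //; exact: dopen_dball.
apply: le_measure; rewrite ?inE//; move=> z; rewrite /dball /=.
have := mX => -[_ [_ [s tr]]]; have := tr x y z; rewrite (s x y); lra.
Qed.

(** An anchor closer to [x] than half of [dX x y] would be equally close to [y], violating the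
    triangle inequality. *)
Lemma anchors_separate {R : realType} {d} {X : measurableType d} (dX : X -> X -> R)
  (mu : set X -> \bar R) (a : nat -> X) (x y : X) :
  is_metric dX -> dense_in_support dX mu a -> msupport dX mu x ->
  (forall r, dX x (a r) = dX y (a r)) -> x = y.
Proof.
move=> [d0 [de [ds dt]]] [_ da] sx h; apply/de/eqP; rewrite eq_le d0 andbT.
rewrite leNgt; apply/negP => xy; have [r hr] := da x sx _ (divr_gt0 xy (ltr0n _ 2)).
have := dt x (a r) y; rewrite (ds (a r) y) -h; lra.
Qed.

(** * Measurability, integrals and uniqueness of measures on the product *)

Section product_space.
Context {R : realType} {dx dy : measure_display} {X : measurableType dx}
  {Y : measurableType dy} {dX : X -> X -> R} {dY : Y -> Y -> R}.
Context (mX : is_metric dX) (cX : metric_compact dX) (bX : borel_for dX).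
Context (mY : is_metric dY) (cY : metric_compact dY) (bY : borel_for dY).

Let dZ := dsum dX dY.
Let mZ : is_metric dZ := is_metric_dsum _ _ mX mY.
Let cZ : metric_compact dZ := metric_compact_dsum _ _ mX mY cX cY.

(** The product sigma-algebra is generated by rectangles, so an open set has to be a countable union
    of boxes; separability provides the boxes. *)
Lemma dopen_dsum_measurable (O : set (X * Y)) : dopen dZ O -> measurable O.
Proof.
move=> oO; have [[z0 Oz0]|nO] := pselect (O !=set0); last first.
  by rewrite (_ : O = set0)//; apply/eqP/negPn/negP => /set0P.
have [c hc] := compact_separable _ z0 mZ cZ.
pose e k : R := k.+1%:R^-1.
pose B k i := dball dX (c k i).1 (e k) `*` dball dY (c k i).2 (e k).
rewrite (_ : O = \bigcup_k \bigcup_(i in [set i | B k i `<=` O]) B k i).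
  apply: bigcup_measurable => k _; apply: bigcup_measurable => i _.
  apply: measurableX.
  - by apply: (measurable_dopen dX) => //; exact: dopen_dball.
  - by apply: (measurable_dopen dY) => //; exact: dopen_dball.
apply/seteqP; split=> [z Oz|z [k _ [i BO Bz]]]; last exact: BO.
have [r r0 hr] := oO z Oz.
(* A centre within [r / 4] of [z], and two coordinates of [w] each within [r / 4] of that centre,
   put [w] within 3r/4 of [z]. *)
have [k hk] := filter_ex (near_inv_lt _ (divr_gt0 r0 (ltr0n _ 4))).
have [i hi] := hc k z; exists k => //; exists i => /=.
- move=> w [/= h1 h2]; apply: hr; move: hi h1 h2.
  case: mZ => _ [_ [s tr]]; have := tr z (c k i) w; rewrite (s z (c k i)).
  rewrite /dball /dZ /dsum /= -/(e k) in hk *; lra.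
- case: mX mY => X0 _ [Y0 _]; have := X0 (c k i).1 z.1; have := Y0 (c k i).2 z.2.
  by move: hi; rewrite /B /dball /dZ /dsum /= -/(e k) => *; split => /=; lra.
Qed.

Lemma dcontinuous_measurable (f : X * Y -> R) :
  dcontinuous dZ rdist f -> measurable_fun setT f.
Proof.
move=> cf mD; apply: (measurability _ (measurable_realfun.RGenOInfty.measurableE R)) => //.
move=> _ [_ [c ->] <-]; rewrite setTI; apply: dopen_dsum_measurable => z /=.
rewrite in_itv /= andbT => cz.
have [r r0 hr] := cf z (f z - c) ltac:(by rewrite subr_gt0).
exists r => // w /hr; rewrite /rdist in_itv /= andbT ltr_norml => /andP[]; lra.
Qed.

Lemma dcontinuous_integrable (lam : {measure set (X * Y) -> \bar R}) (f : X * Y -> R) :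
  lam setT = 1%E -> dcontinuous dZ rdist f -> lam.-integrable setT (EFin \o f).
Proof.
move=> l1 cf; apply: measurable_bounded_integrable => //.
- by rewrite l1 ltry.
- exact: dcontinuous_measurable.
- have [M hM] := dcontinuous_bounded _ _ mZ cZ cf.
  by exists M; split => [|r Mr z _]; [exact: num_real|exact: le_trans (hM z) (ltW Mr)].
Qed.

(** Both integrals are restricted to the complement of the null set [N], whose mass is at most 1. *)
Lemma Rintegral_close (lam : {measure set (X * Y) -> \bar R}) (N : set (X * Y))
    (f g : X * Y -> R) (e : R) :
  0 <= e -> lam setT = 1%E -> measurable N -> lam N = 0%E ->
  dcontinuous dZ rdist f -> dcontinuous dZ rdist g ->
  (forall z, ~ N z -> `|f z - g z| <= e) ->
  `|Rintegral lam setT f - Rintegral lam setT g| <= e.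
Proof.
move=> e0 l1 mN N0 cf cg fg.
have RN h : lam.-integrable setT (EFin \o h) ->
    Rintegral lam setT h = Rintegral lam (~` N) h.
  by move=> ih; rewrite /Rintegral (negligible_integral mN _ ih)// setTD.
have mC : measurable (~` N) by exact: measurableC.
have if_ := dcontinuous_integrable _ _ l1 cf.
have ig := dcontinuous_integrable _ _ l1 cg.
have iC h : lam.-integrable setT (EFin \o h) -> lam.-integrable (~` N) (EFin \o h).
  by apply: integrableS.
have lC : (lam (~` N) <= 1)%E by rewrite -l1 le_measure ?inE.
have lCfin : lam (~` N) \is a fin_num by rewrite ge0_fin_numE// (le_lt_trans lC)// ltry.
have i1 r : lam.-integrable (~` N) (EFin \o cst r).
  apply: measurable_bounded_integrable => //; first by rewrite -ge0_fin_numE.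
  by exists `|r|; split => [|s rs z _]; [exact: num_real|exact: ltW].
rewrite !RN// -RintegralB//; [|exact: iC..].
have iB : lam.-integrable (~` N) (EFin \o (fun z => f z - g z)).
  by have := integrableB mC (iC _ if_) (iC _ ig).
apply: le_trans (le_normr_Rintegral mC iB) _.
apply: (@le_trans _ _ (\int[lam]_(z in ~` N) (cst e z))).
  by apply: le_Rintegral => //; exact: (integrable_norm iB).
rewrite Rintegral_cst// ler_piMr// -lee_fin fineK//.
Qed.

(* A pi-system generating the product sigma-algebra; [clamp (k g)] increases to the
   indicator of [g > 0]. *)
Definition lipschitz_positive : set (set (X * Y)) :=
  [set C | exists L g, [/\ 0 <= L, dlipschitz dZ L g & C = [set z | 0 < g z]]].

(** It suffices to treat preimages of open sets under the two projections, and these are positivity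
    sets of a distance function composed with a projection. *)
Lemma measurable_lipschitz_positive (C : set (X * Y)) :
  measurable C -> <<s lipschitz_positive >> C.
Proof.
apply: smallest_sub; first exact: smallest_sigma_algebra.
have [X0 _] := mX; have [Y0 _] := mY.
rewrite subUset; split => _ [A mA <-].
- move: mA; rewrite /= bX; apply: (smallest_sub (@sigma_algebra_image _ _ setT fst _
    (smallest_sigma_algebra _ lipschitz_positive))).
  move=> O oO; rewrite /image_set_system /=; apply: sub_sigma_algebra.
  have [g lg ->] := dopen_positive_set _ _ mX oO.
  exists 1, (g \o fst); split => //; last by rewrite setTI.
  move=> z w /=; apply: (le_trans (lg z.1 w.1)).
  by rewrite lerD2l !mul1r lerDl Y0.
- move: mA; rewrite /= bY; apply: (smallest_sub (@sigma_algebra_image _ _ setT snd _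
    (smallest_sigma_algebra _ lipschitz_positive))).
  move=> O oO; rewrite /image_set_system /=; apply: sub_sigma_algebra.
  have [g lg ->] := dopen_positive_set _ _ mY oO.
  exists 1, (g \o snd); split => //; last by rewrite setTI.
  move=> z w /=; apply: (le_trans (lg z.2 w.2)).
  by rewrite lerD2l !mul1r lerDr X0.
Qed.

Lemma dcontinuous_positive_set (g : X * Y -> R) :
  dcontinuous dZ rdist g -> measurable [set z | 0 < g z].
Proof.
move=> cg; apply: dopen_dsum_measurable => z /= gz; have [r r0 hr] := cg z _ gz.
by exists r => // w /hr; rewrite /rdist ltr_norml => /andP[]; lra.
Qed.

Lemma clamp_cvg (t : R) :
  Num.max 0 (Num.min 1 (k%:R * t)) @[k --> \oo] --> ((0 < t)%R%:R : R).
Proof.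
apply: cvg_near_cst; case: ltP => t0.
- have [k0 hk] := filter_ex (near_inv_lt _ t0).
  exists k0.+1 => // k /= k0k; suff h : 1 <= k%:R * t by rewrite min_l// max_r.
  have kp : 0 < k%:R :> R by rewrite ltr0n (leq_trans _ k0k).
  rewrite -ler_pdivrMl// mulr1; apply: le_trans (ltW hk).
  by rewrite lef_pV2 ?posrE// ler_nat.
- by exists 0%N => // k _ /=; rewrite max_l// ge_min mulr_ge0_le0 ?orbT.
Qed.

(** By dominated convergence the integrals of the Lipschitz functions [F g k] tend to the measure of
    the positivity set of [g]. Hence both measures agree on the pi-system [lipschitz_positive], and
    so everywhere. *)
Lemma eq_measure_Rintegral (m1 m2 : {measure set (X * Y) -> \bar R}) :
  m1 setT = 1%E -> m2 setT = 1%E ->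
  (forall f, dcontinuous dZ rdist f -> Rintegral m1 setT f = Rintegral m2 setT f) ->
  forall C, measurable C -> m1 C = m2 C.
Proof.
move=> m11 m21 m12 C mC.
pose F (g : X * Y -> R) k z := Num.max 0 (Num.min 1 (k%:R * g z)).
have cF L g k : 0 <= L -> dlipschitz dZ L g -> dcontinuous dZ rdist (F g k).
  move=> L0 lg; apply: (dlipschitz_dcontinuous _ (k%:R * L)) => //; first exact: mulr_ge0.
  move=> z w; rewrite /F.
  have : 0 <= k%:R * L * dZ z w by rewrite !mulr_ge0//; case: mZ.
  have := ler_wpM2l (ler0n R k) (lg z w); rewrite mulrDr mulrA.
  move: (_ * dZ z w) (k%:R * g z) (k%:R * g w) => A B E BE A0.
  rewrite ge_max ge_min; case: (leP 0 (Num.min 1 E)); case: (leP 1 E) => ? ?; apply/andP; split;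
   try apply/orP; lra.
have lim (m : {measure set (X * Y) -> \bar R}) L g : m setT = 1%E -> 0 <= L -> dlipschitz dZ L g ->
    (\int[m]_z (F g k z)%:E)%E @[k --> \oo] --> m [set z | 0 < g z].
  move=> mT L0 lg.
  have cg : dcontinuous dZ rdist g by exact: dlipschitz_dcontinuous L0 lg.
  have mg := dcontinuous_positive_set _ cg.
  rewrite -[[set z | 0 < g z]]setIT -integral_indic//.
  apply: (@dominated_cvg _ _ _ m setT _ _ _ (cst 1%E)) => //.
  - move=> k; apply/measurable_realfun.measurable_EFinP; apply: dcontinuous_measurable; exact: (cF L).
  - move=> z _; apply: cvg_EFin; first by exists 0%N.
    rewrite indicE (_ : (z \in _) = (0 < g z)); first exact: clamp_cvg.
    by apply/idP/idP; rewrite inE.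
  - apply: (dcontinuous_integrable m (cst 1)) => // z e e0.
    by exists 1 => // w _; rewrite /rdist subrr normr0.
  - move=> k z _; rewrite /F abse_EFin lee_fin ger0_norm ?le_max ?lexx// ge_max ler01 /=.
    by rewrite ge_min lexx.
apply: (measure_unique lipschitz_positive (fun=> setT)) => //.
- apply/seteqP; split; first exact: measurable_lipschitz_positive.
  apply: smallest_sub; first exact: sigma_algebra_measurable.
  by move=> _ [L [g [L0 lg ->]]];
  exact: dcontinuous_positive_set (dlipschitz_dcontinuous _ _ _ mZ L0 lg).
(* Closure under intersection: two positivity sets meet in the positivity set of the minimum. *)
- move=> _ _ [L [g [L0 lg ->]]] [M [h [M0 lh ->]]].
  exists (L + M), (fun z => Num.min (g z) (h z)); split; first exact: addr_ge0.
  + exact: dlipschitz_min.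
  + apply/seteqP; split => z /=; rewrite lt_min; [by move=> [-> ->]|by move/andP].
- move=> _; exists 0, (cst 1); split => //; first by move=> z w; rewrite mul0r addr0.
  by apply/seteqP; split => // z _ /=; exact: ltr01.
- by apply/seteqP; split => // z _; exists 0%N.
- move=> _ [L [g [L0 lg ->]]].
  apply: (cvg_unique _ (lim m1 L g m11 L0 lg)) => //.
  rewrite (_ : (fun k => _) = (fun k => (\int[m2]_z (F g k z)%:E)%E)).
    exact: (lim m2 L g m21 L0 lg).
  apply/funext => k; have ck := cF L g k L0 lg.
  (* The hypothesis concerns real-valued integrals; finiteness transfers it to the extended ones. *)
  rewrite -[LHS]fineK ?integrable_fin_num//; last exact: dcontinuous_integrable ck.
  rewrite -[RHS]fineK ?integrable_fin_num//; last exact: dcontinuous_integrable ck.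
  by have := m12 _ ck; rewrite /Rintegral => ->.
- by move=> _; rewrite m11 ltry.
Qed.

End product_space.

(** * Distances between arrays, and arrays of a single point *)

(* The McShane extension is built for the l1 distance, whose triangle inequality is
   immediate, and compared with [eucl_dist] through the cardinality of the index set. *)
Definition l1_dist {R : realType} {I : finType} (v w : I -> R) : R :=
  \sum_(k : I) `|v k - w k|.

Lemma coord_le_l1_dist {R : realType} {I : finType} (v w : I -> R) (k : I) :
  `|v k - w k| <= l1_dist v w.
Proof. by rewrite /l1_dist (bigD1 k)//= lerDl sumr_ge0. Qed.

Lemma l1_dist_ge0 {R : realType} {I : finType} (v w : I -> R) : 0 <= l1_dist v w.
Proof. exact: sumr_ge0. Qed.

Lemma l1_dist_triangle {R : realType} {I : finType} (u v w : I -> R) :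
  l1_dist u w <= l1_dist u v + l1_dist v w.
Proof. by rewrite /l1_dist -big_split; apply: ler_sum => k _; exact: ler_distD. Qed.

Lemma l1_dist_le_card {R : realType} {I : finType} (v w : I -> R) (c : R) :
  (forall k, `|v k - w k| <= c) -> l1_dist v w <= #|I|%:R * c.
Proof.
move=> h; rewrite /l1_dist mulr_natl -[X in _ <= X]sumr_const.
by apply: ler_sum => k _; exact: h.
Qed.

Lemma coord_le_eucl_dist {R : realType} {I : finType} (v w : I -> R) (k : I) :
  `|v k - w k| <= eucl_dist v w.
Proof.
rewrite /eucl_dist -sqrtr_sqr ler_wsqrtr// (bigD1 k)//= lerDl sumr_ge0// => i _.
exact: sqr_ge0.
Qed.

(** The tuple is written in the form to which [prod_integral] reduces for [n = 1], so [Phi_integral]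
    with [n = m = 1] unfolds to one integral over this array. *)
Definition point_array {R : realType} {X Y : Type} (dX : X -> X -> R) (dY : Y -> Y -> R)
  (T : X -> X) (S : Y -> Y) (a : nat -> X) (b : nat -> Y) (Ra : nat) (z : X * Y) :=
  full_array dX dY T S a b 1 1 Ra [tuple of z :: [tuple]].

(** An entry is either the distance of a point to itself, hence 0, or the distance to an anchor,
    which is 1-Lipschitz. *)
Lemma point_array_lip {R : realType} {X Y : Type} (dX : X -> X -> R) (dY : Y -> Y -> R)
  (T : X -> X) (S : Y -> Y) (a : nat -> X) (b : nat -> Y) (Ra : nat) (z w : X * Y) k :
  is_metric dX -> is_metric dY ->
  `|point_array dX dY T S a b Ra z k - point_array dX dY T S a b Ra w k| <= dsum dX dY z w.
Proof.
move=> mX mY; have [X0 _] := mX; have [Y0 _] := mY; rewrite /dsum.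
case: k => [[[[[i p] j] q]|[[i p] r]]|[[[[i p] j] q]|[[i p] r]]];
  rewrite /point_array /full_array /anchored_array !ord1 /=.
- by rewrite !metric_refl// subrr normr0 addr_ge0.
- by apply: (le_trans (metric_lip _ (a r) z.1 w.1 mX)); rewrite lerDl.
- by rewrite !metric_refl// subrr normr0 addr_ge0.
- by apply: (le_trans (metric_lip _ (b r) z.2 w.2 mY)); rewrite lerDr.
Qed.

(** * Approximation of continuous functions by Lipschitz functions of arrays *)

Section approximation.
Context {R : realType} {dx dy : measure_display} {X : measurableType dx}
  {Y : measurableType dy} {dX : X -> X -> R} {dY : Y -> Y -> R}.
Context (mX : is_metric dX) (cX : metric_compact dX) (bX : borel_for dX).
Context (mY : is_metric dY) (cY : metric_compact dY) (bY : borel_for dY).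
Context (mu : {measure set X -> \bar R}) (nu : {measure set Y -> \bar R})
  (T : X -> X) (S : Y -> Y) (a : nat -> X) (b : nat -> Y).
Context (da : dense_in_support dX mu a) (db : dense_in_support dY nu b).

Let dZ := dsum dX dY.
Let mZ : is_metric dZ := is_metric_dsum _ _ mX mY.
Let cZ : metric_compact dZ := metric_compact_dsum _ _ mX mY cX cY.
Let K := msupport dX mu `*` msupport dY nu.
Let D Ra := point_array dX dY T S a b Ra.

(** This is [separating_modulus] for the distances to the anchors, each of which is an array entry
    and so is controlled by [l1_dist]. Using [N.+1] anchors guarantees at least one. *)
Lemma array_modulus (f : X * Y -> R) (e : R) : dcontinuous dZ rdist f -> 0 < e ->
  exists (N : nat) (eta : R), 0 < eta /\
    forall z w, K z -> K w -> l1_dist (D N.+1 z) (D N.+1 w) < eta -> `|f z - f w| < e.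
Proof.
move=> cf e0.
(* Even indices enumerate the anchors of [X], odd ones those of [Y]. *)
pose g r (z : X * Y) := if odd r then dY z.2 (b r./2) else dX z.1 (a r./2).
have [X0 _] := mX; have [Y0 _] := mY.
have clK z : (forall r : R, 0 < r -> exists2 w, K w & dZ w z < r) -> K z.
  move=> h; split; apply: msupport_closed => // r r0;
    have [w [K1 K2] zw] := h r r0; [exists w.1|exists w.2] => //;
    apply: le_lt_trans zw; rewrite /dZ /dsum; [by rewrite lerDl|by rewrite lerDr].
have lg r z w : `|g r z - g r w| <= dZ z w.
  rewrite /g /dZ /dsum; case: ifP => _.
  - by apply: (le_trans (metric_lip _ _ _ _ mY)); rewrite lerDr.
  - by apply: (le_trans (metric_lip _ _ _ _ mX)); rewrite lerDl.
have sg z w : K z -> K w -> (forall r, g r z = g r w) -> z = w.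
  case: z w => [x y] [x' y'] [/= K1 K2] _ h; congr pair.
  - by apply: (anchors_separate dX mu a) => // r; have := h r.*2; rewrite /g odd_double doubleK.
  - apply: (anchors_separate dY nu b) => // r; have := h r.*2.+1.
    by rewrite /g /= odd_double /= uphalf_double.
have [N [eta [eta0 hN]]] := separating_modulus dZ K g f e mZ cZ clK lg sg cf e0.
exists N, eta; split => // z w Kz Kw zw; apply: hN => // r rN; apply: le_lt_trans zw.
have hr : (r./2 < N.+1)%N by rewrite ltnS -divn2 (leq_trans (leq_div _ _))// ltnW.
pose k : 'I_1 * 'I_1 * 'I_N.+1 := (ord0, ord0, Ordinal hr).
have := coord_le_l1_dist (D N.+1 z) (D N.+1 w) (if odd r then inr (inr k) else inl (inr k)).
by rewrite /g; case: ifP.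
Qed.

Lemma array_approximation (f : X * Y -> R) (e : R) : dcontinuous dZ rdist f -> 0 < e ->
  exists (Ra : nat) (L : R) (psi : (fullIdx 1 1 Ra -> R) -> R),
    [/\ (0 < Ra)%N, 0 < L, lipschitz1_on (array_cube dX dY 1 1 Ra) psi,
        dcontinuous dZ rdist (fun z => L * psi (D Ra z)) &
        forall z, K z -> `|f z - L * psi (D Ra z)| <= e].
Proof.
move=> cf e0; have [N [eta [eta0 hN]]] := array_modulus f e cf e0.
have [M hM] := dcontinuous_bounded dZ f mZ cZ cf.
have M0 : 0 <= M by exact: le_trans (hM (a 0%N, b 0%N)).
(* [L1 * eta] exceeds the oscillation of [f], which is at most [2 * M], so arrays at distance at
   least [eta] are harmless. The factor [c] pays for passing from [l1_dist] to a bound on single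
   coordinates; its successor keeps it positive. *)
pose L1 := 2 * (M + 1) / eta; pose c : R := #|fullIdx 1 1 N.+1|.+1%:R.
have c0 : 0 < c by rewrite ltr0n.
have L10 : 0 < L1 by rewrite divr_gt0// mulr_gt0// ltr_wpDl.
have Lc0 : 0 < L1 * c by exact: mulr_gt0.
have K0 : K !=set0 by exists (a 0%N, b 0%N); split; [exact: da.1|exact: db.1].
have fM w : K w -> - M <= f w by move=> _; have := hM w; rewrite ler_norml => /andP[].
have [psi [lp up dn]] := mcshane l1_dist K f (D N.+1) L1 (- M) K0 (ltW L10)
  l1_dist_ge0 l1_dist_triangle fM.
(* Used with [r] the Euclidean distance for the Lipschitz bound, and with [r = dZ z w] for
   continuity in the point. *)
have lc v w r : 0 <= r -> (forall k, `|v k - w k| <= r) -> psi v <= psi w + L1 * c * r.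
  move=> r0 h; apply: (le_trans (lp v w)); rewrite lerD2l -mulrA ler_pM2l//.
  by apply: (le_trans (l1_dist_le_card _ _ _ h)); rewrite ler_wpM2r// ler_nat.
exists N.+1, (L1 * c), (fun v => psi v / (L1 * c)); split => //.
- move=> v w _ _; rewrite -mulrBl normrM normfV (gtr0_norm Lc0) ler_pdivrMr// mulrC.
  have E0 (v' w' : fullIdx 1 1 N.+1 -> R) : 0 <= eucl_dist v' w' by exact: sqrtr_ge0.
  have h1 := lc v w _ (E0 v w) (coord_le_eucl_dist v w).
  have h2 : psi w <= psi v + L1 * c * eucl_dist v w.
    by apply: lc => // k; rewrite distrC coord_le_eucl_dist.
  by rewrite ler_norml; apply/andP; split; lra.
- rewrite (_ : (fun z => _) = (fun z => psi (D N.+1 z))); last first.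
    by apply/funext => z; rewrite mulrC divfK// gt_eqF.
  apply: (dlipschitz_dcontinuous _ (L1 * c)) => //; first exact: ltW.
  by move=> z w; apply: lc => [|k]; [case: mZ|exact: point_array_lip].
(* The point [z] itself competes in the infimum at array distance 0, so the extension lies below
   [f z]; only the lower bound [f z - e] remains. *)
- move=> z Kz; rewrite mulrC divfK ?gt_eqF// ger0_norm; last first.
    rewrite subr_ge0; apply: (le_trans (up _ z Kz)).
    by rewrite /l1_dist big1 ?mulr0 ?addr0// => k _; rewrite subrr normr0.
  rewrite lerBlDl -lerBlDr; apply: dn => w Kw.
  have [h|h] := ltP (l1_dist (D N.+1 z) (D N.+1 w)) eta.
    have := hN z w Kz Kw h; rewrite ltr_norml => /andP[_ ?].
    have := mulr_ge0 (ltW L10) (l1_dist_ge0 (D N.+1 z) (D N.+1 w)); lra.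
  have := hM z; have := hM w; rewrite !ler_norml => /andP[? ?] /andP[? ?].
  have : L1 * eta <= L1 * l1_dist (D N.+1 z) (D N.+1 w) by rewrite ler_pM2l.
  rewrite {1}/L1 divfK ?gt_eqF//; lra.
Qed.

(** A measure with marginals [mu] and [nu] gives no mass to the points having a coordinate in [N1]
    or [N2], so the approximation on [K] suffices. The bound is uniform over such measures. *)
Lemma Rintegral_array_approximation (lam : {measure set (X * Y) -> \bar R})
    (f : X * Y -> R) (Ra : nat) (L e : R) (psi : (fullIdx 1 1 Ra -> R) -> R) :
  lam setT = 1%E -> (forall A, measurable A -> lam (A `*` setT) = mu A) ->
  (forall B, measurable B -> lam (setT `*` B) = nu B) ->
  0 <= e -> 0 < L -> dcontinuous dZ rdist f ->
  dcontinuous dZ rdist (fun z => L * psi (D Ra z)) ->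
  (forall z, K z -> `|f z - L * psi (D Ra z)| <= e) ->
  `|Rintegral lam setT f - L * Phi_integral dX dY T S a b 1 1 Ra psi lam| <= e.
Proof.
move=> l1 lmu lnu e0 L0 cf ch fh.
have [N1 [mN1 N10 hN1]] := msupport_conull dX mu mX cX bX.
have [N2 [mN2 N20 hN2]] := msupport_conull dY nu mY cY bY.
pose N := (N1 `*` setT) `|` (setT `*` N2).
have mA : measurable (N1 `*` [set: Y]) by exact: measurableX.
have mB : measurable ([set: X] `*` N2) by exact: measurableX.
have N0 : lam N = 0%E by rewrite measureU0// ?lmu// lnu.
have := Rintegral_close mX cX bX mY cY bY lam N f _ e e0 l1 (measurableU _ _ mA mB) N0 cf ch.
have <- : L * Phi_integral dX dY T S a b 1 1 Ra psi lam =
    Rintegral lam setT (fun z => L * psi (D Ra z)).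
  (* Continuity, hence integrability, is known for [L * psi (D Ra z)]; linearity is therefore
     applied with the factor [L^-1]. *)
  have Lne : L != 0 by rewrite gt_eqF.
  rewrite -[RHS](mulVKf Lne); congr (_ * _).
  have ih := dcontinuous_integrable mX cX bX mY cY bY lam _ l1 ch.
  rewrite -(RintegralZl L^-1 measurableT ih); congr Rintegral.
  by apply/funext => z; rewrite mulKf.
apply => z Nz; apply: fh; split; [apply: hN1|apply: hN2] => h; apply: Nz; [left|right]; by split.
Qed.

End approximation.

(** * Separation of joinings and control of weak neighborhoods *)

Lemma prod_continuous_dcontinuous {R : realType} {X Y : Type} (dX : X -> X -> R)
  (dY : Y -> Y -> R) (f : X * Y -> R) : is_metric dX -> is_metric dY ->
  prod_continuous dX dY f -> dcontinuous (dsum dX dY) rdist f.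
Proof.
move=> [X0 _] [Y0 _] cf z e e0; have [r r0 hr] := cf z e e0; exists r => // w zw.
by apply: hr; apply: le_lt_trans zw; rewrite /dsum; [rewrite lerDl|rewrite lerDr].
Qed.

Theorem theorem26 (R : realType)
  (dx dy : measure_display) (X : measurableType dx) (Y : measurableType dy)
  (dX : X -> X -> R) (dY : Y -> Y -> R)
  (mu : probability X R) (nu : probability Y R) (T : X -> X) (S : Y -> Y)
  (a : nat -> X) (b : nat -> Y) :
  is_metric dX -> metric_compact dX -> borel_for dX ->
  is_metric dY -> metric_compact dY -> borel_for dY ->
  preserves mu T -> preserves nu S ->
  dcontinuous dX dX T -> dcontinuous dY dY S ->
  dense_in_support dX mu a -> dense_in_support dY nu b ->
  (* (1) *)
  (forall lam : probability (X * Y)%type R, joining mu nu T S lam ->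
     ~ (forall C, measurable C -> lam C = (mu \x nu)%E C) ->
     exists (n m Ra : nat) (psi : (fullIdx n m Ra -> R) -> R),
       [/\ (0 < n)%N, (0 < m)%N, (0 < Ra)%N,
           lipschitz1_on (array_cube dX dY n m Ra) psi &
           Phi_integral dX dY T S a b n m Ra psi lam
             <> Phi_integral dX dY T S a b n m Ra psi (mu \x nu)%E])
  /\
  (* (2) *)
  (forall U : set (probability (X * Y)%type R),
     weak_nbhd_in_J dX dY mu nu T S (mu \x nu)%E U ->
     exists (L : nat) (ns ms Rs : 'I_L -> nat)
            (psi : forall l : 'I_L, (fullIdx (ns l) (ms l) (Rs l) -> R) -> R)
            (eps : R),
       [/\ (forall l, [/\ (0 < ns l)%N, (0 < ms l)%N & (0 < Rs l)%N]),
           (forall l, lipschitz1_on (array_cube dX dY (ns l) (ms l) (Rs l)) (psi l)),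
           0 < eps &
           forall lam : probability (X * Y)%type R, joining mu nu T S lam ->
             (forall l, `|Phi_integral dX dY T S a b (ns l) (ms l) (Rs l) (psi l) lam
                          - Phi_integral dX dY T S a b (ns l) (ms l) (Rs l) (psi l) (mu \x nu)%E| < eps) ->
             U lam]).
Proof.
move=> mX cX bX mY cY bY _ _ _ _ da db.
pose lam0 : {measure set (X * Y) -> \bar R} := (mu \x nu)%E.
have lam0X (A : set X) (B : set Y) : measurable A -> measurable B ->
    lam0 (A `*` B) = (mu A * nu B)%E by exact: product_measure1E.
have l01 : lam0 setT = 1%E by rewrite -setXTT lam0X// !probability_setT mule1.
have l0mu A : measurable A -> lam0 (A `*` setT) = mu A.
  by move=> mA; rewrite lam0X// probability_setT mule1.
have l0nu B : measurable B -> lam0 (setT `*` B) = nu B.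
  by move=> mB; rewrite lam0X// probability_setT mul1e.
have approx := array_approximation mX cX bX mY cY bY mu nu T S a b da db.
have close := Rintegral_array_approximation mX cX bX mY cY bY mu nu T S a b.
split.
- move=> lam [lmu [lnu _]] lneq; apply: contrapT => nex; apply: lneq.
  apply: (eq_measure_Rintegral mX cX bX mY cY bY lam lam0) => //.
    exact: probability_setT.
  move=> f cf; apply/eqP; rewrite -subr_eq0 -normr_le0; apply/ler_addgt0Pr => e e0.
  have e2 : 0 < e / 2 by rewrite divr_gt0.
  have [Ra [L [psi [Ra0 L0 lpsi cpsi fpsi]]]] := approx f _ cf e2.
  have h1 := close lam f Ra L _ psi (probability_setT lam) lmu lnu (ltW e2) L0 cf cpsi fpsi.
  have h0 := close lam0 f Ra L _ psi l01 l0mu l0nu (ltW e2) L0 cf cpsi fpsi.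
  (* If no array integral separates [lam] from [lam0], this one agrees, and both integrals of [f]
     lie within [e / 2] of the same number. *)
  have E : Phi_integral dX dY T S a b 1 1 Ra psi lam = Phi_integral dX dY T S a b 1 1 Ra psi lam0.
    by apply: contrapT => ne; apply: nex; exists 1%N, 1%N, Ra, psi.
  rewrite -E distrC in h0; rewrite add0r.
  apply: (le_trans (ler_distD _ _ _)); apply: (le_trans (lerD h1 h0)); lra.
- move=> U [k [f [dl [cf [dl0 hU]]]]].
  (* Three errors of at most [dl / 4] will add up to less than [dl]: one approximation for each
     measure and the gap between array integrals. *)
  have dl4 : 0 < dl / 4 by rewrite divr_gt0.
  have cf' i := prod_continuous_dcontinuous dX dY (f i) mX mY (cf i).
  (* The type of [psi] depends on [Ra], so the choice is made in a dependent sum. The estimate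
     ranges over all measures with the given marginals, so one [psi] serves both [lam] and
     [lam0]. *)
  have /choice[F hF] : forall i : 'I_k,
      exists t : {Ra : nat & (R * ((fullIdx 1 1 Ra -> R) -> R))%type},
      let: existT Ra (L, psi) := t in
      [/\ (0 < Ra)%N, 0 < L, lipschitz1_on (array_cube dX dY 1 1 Ra) psi &
        forall lam : {measure set (X * Y) -> \bar R}, lam setT = 1%E ->
          (forall A, measurable A -> lam (A `*` setT) = mu A) ->
          (forall B, measurable B -> lam (setT `*` B) = nu B) ->
          `|Rintegral lam setT (f i) - L * Phi_integral dX dY T S a b 1 1 Ra psi lam|
            <= dl / 4].
    move=> i; have [Ra [L [psi [Ra0 L0 lpsi cpsi fpsi]]]] := approx (f i) _ (cf' i) dl4.
    exists (existT _ Ra (L, psi)); split => // lam l1 lmu lnu.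
    exact: close (ltW dl4) L0 (cf' i) cpsi fpsi.
  pose Rs i := projT1 (F i); pose Ls i := (projT2 (F i)).1; pose psi i := (projT2 (F i)).2.
  have {}hF i : [/\ (0 < Rs i)%N, 0 < Ls i,
      lipschitz1_on (array_cube dX dY 1 1 (Rs i)) (psi i) &
      forall lam : {measure set (X * Y) -> \bar R}, lam setT = 1%E ->
        (forall A, measurable A -> lam (A `*` setT) = mu A) ->
        (forall B, measurable B -> lam (setT `*` B) = nu B) ->
        `|Rintegral lam setT (f i) -
          Ls i * Phi_integral dX dY T S a b 1 1 (Rs i) (psi i) lam| <= dl / 4].
    by have := hF i; rewrite /Rs /Ls /psi; case: (F i) => Ra [L ps].
  (* [Lsum] dominates every [Ls i], giving one tolerance for all indices; the summand 1 keeps it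
     positive when [k = 0]. *)
  pose Lsum : R := 1 + \sum_i Ls i.
  have Ls0 i : 0 <= Ls i by case: (hF i) => _ /ltW.
  have Lsum0 : 0 < Lsum by rewrite ltr_wpDr// sumr_ge0.
  exists k, (fun=> 1%N), (fun=> 1%N), Rs, psi, (dl / 4 / Lsum); split.
  + by move=> l; split => //; case: (hF l).
  + by move=> l; case: (hF l).
  + exact: divr_gt0.
  move=> lam jlam hl; apply: (hU lam jlam) => i.
  have [lmu [lnu _]] := jlam; have [_ Li0 _ hi] := hF i.
  have h1 := hi lam (probability_setT lam) lmu lnu.
  have h0 := hi lam0 l01 l0mu l0nu.
  have h2 := hl i; rewrite ltr_pdivlMr// mulrC in h2.
  have Lle : Ls i <= Lsum.
    by rewrite /Lsum (bigD1 i)//= addrCA lerDl addr_ge0// sumr_ge0.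
  have {}h2 := le_lt_trans (ler_wpM2r (normr_ge0 _) Lle) h2.
  rewrite -{1}(gtr0_norm Li0) -normrM mulrBr in h2.
  apply: (le_lt_trans (ler_distD (Ls i * Phi_integral dX dY T S a b 1 1 (Rs i) (psi i) lam) _ _)).
  apply: (le_lt_trans (lerD h1 (ler_distD
    (Ls i * Phi_integral dX dY T S a b 1 1 (Rs i) (psi i) lam0) _ _))).
  rewrite distrC in h0; lra.
Qed.
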